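(* Let $d\ge 2$ be an integer, let $p$ be a prime with $d\mid p-1$, and let $\lambda$ be an integer not divisible by $p$. For $\mu\in\{0,\lambda\}$ let $N_{\mathbb{F}_p}(\mu)$ be the number of $\mathbb{F}_p$-points of the hypersurface $x_1^d+x_2^d-d\mu\, x_1x_2^{d-1}=0$ in $\mathbb{P}^1_{\mathbb{F}_p}$. Put $\alpha_k=\frac{k}{d}$ for $1\le k\le d-1$ and $\beta_k=\frac{k}{d-1}$ for $1\le k\le d-2$, and for $0\le i\le d-2$ let $$\alpha^{(i)}=(\alpha_1+1,\dots,\alpha_i+1,\alpha_{i+1},\dots,\alpha_{d-1}),\qquad \beta^{(i)}=(\beta_1+1,\dots,\beta_i+1,\beta_{i+1},\dots,\beta_{d-2}).$$ Then $$N_{\mathbb{F}_p}(\lambda)-N_{\mathbb{F}_p}(0)\equiv\sum_{i=0}^{d-2}\left[{}_{d-1}F_{d-2}\left(\alpha^{(i)};\beta^{(i)}\,\middle|\,(d-1)^{-(d-1)}\lambda^{-d}\right)\right]_{\frac{i(p-1)}{d-1}}^{\frac{(i+1)(p-1)}{d}-1}\pmod p.$$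
   Context: The generalized hypergeometric series is $${}_AF_B(\alpha_1,\dots,\alpha_A;\beta_1,\dots,\beta_B|z)=\sum_{k=0}^{\infty}\frac{(\alpha_1)_k\cdots(\alpha_A)_k}{(\beta_1)_k\cdots(\beta_B)_k}\frac{z^k}{k!},\qquad (x)_k=x(x+1)\cdots(x+k-1),\ (x)_0=1.$$ For a power series $u(z)=\sum_k u_kz^k$, the notation $[u(z)]_a^b$ denotes the truncation $\sum_{a\le k\le b}u_kz^k$, the sum being over integers $k$ with $a\le k\le b$ (the bounds may be rational numbers). The congruence modulo $p$ is between elements of the ring $\mathbb{Z}_{(p)}$ of rational numbers with denominator prime to $p$. *)

(* Defs.v *)
From HB Require Import structures.
From mathcomp Require Import all_boot all_order all_algebra.

Set Implicit Arguments.
Unset Strict Implicit.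
Unset Printing Implicit Defensive.

Import Order.TTheory GRing.Theory Num.Theory.
Local Open Scope ring_scope.

Section ProjectiveSpace.

Variables (F : finFieldType) (n : nat).

Definition proportional (v w : 'rV[F]_n.+1) : bool :=
  [exists c : F, (c != 0) && (w == c *: v)].

(* A point of P^n(F) is the set of all its homogeneous coordinate vectors. *)
Definition proj_points : {set {set 'rV[F]_n.+1}} :=
  equivalence_partition proportional [set v | v != 0].

(* Meaningful for homogeneous [f], whose vanishing does not depend on the
   representative of a point. *)
Definition proj_zeros (f : 'rV[F]_n.+1 -> F) : {set {set 'rV[F]_n.+1}} :=
  [set P in proj_points | [forall v in P, f v == 0]].

End ProjectiveSpace.

(* The coordinates x_1, x_2 are [v 0 0] and [v 0 1]. *)
Definition dwork_form (F : finFieldType) (d : nat) (mu : F)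
    (v : 'rV[F]_2) : F :=
  v 0 0 ^+ d + v 0 1 ^+ d - d%:R * mu * v 0 0 * v 0 1 ^+ (d - 1).

Definition num_points (p d : nat) (mu : int) : nat :=
  #|proj_zeros (dwork_form d (mu%:~R : 'F_p))|.

Section Hypergeometric.

Variable K : fieldType.

Definition pochhammer (x : K) (k : nat) : K := \prod_(j < k) (x + j%:R).

Definition hypergeometric (alpha beta : seq K) (k : nat) : K :=
  (\prod_(a <- alpha) pochhammer a k) /
  (\prod_(b <- beta) pochhammer b k) / k`!%:R.

End Hypergeometric.

(* A power series is given by its sequence of coefficients. The bound
   [Num.truncn b] only makes the index range finite: every natural number
   k <= b satisfies k <= Num.truncn b. *)
Definition truncation (u : nat -> rat) (a b : rat) : {poly rat} :=
  \sum_(k < (Num.truncn b).+1 | a <= k%:R <= b) u k *: 'X^k.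

Definition alpha_params (d : nat) : seq rat :=
  [seq k%:R / d%:R | k <- iota 1 (d - 1)].

Definition beta_params (d : nat) : seq rat :=
  [seq k%:R / (d - 1)%:R | k <- iota 1 (d - 2)].

Definition shift_params (i : nat) (s : seq rat) : seq rat :=
  [seq x + 1 | x <- take i s] ++ drop i s.

Definition p_integral (p : nat) (x : rat) : bool := coprime p `|denq x|.

Definition congr_Zp (p : nat) (x y : rat) : Prop :=
  [/\ p_integral p x, p_integral p y &
      exists2 z : rat, p_integral p z & x - y = p%:R * z].

(* Main.v *)
Require Import Defs.
From mathcomp Require Import all_boot all_order all_algebra all_field.
From mathcomp Require Import zify ring.

(* In the chart x_2 = 1 the number of points is, modulo p, minus the sum over
   t in F_p of f(t)^(p-1) with f(t) = t^d + 1 - d mu t. Expanding by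
   (x - w)^(p-1) = \sum_c x^(p-1-c) w^c, valid in characteristic p, and summing
   the powers of t leaves the terms C(p-1-c, a) (d mu)^c with p - 1 dividing
   d a + c; those with c = 0 make up the count for mu = 0.
   On the other side, the shifts of the parameters are such that the product of
   the (alpha_j^(i))_k equals (d k + i)! / (i! d^(d k) k!), and likewise for
   beta, so that the k-th term of the i-th truncated series is exactly
   C(d k + i, k) (d lambda)^(-d k). The two sums match term by term under
   a = k, c = (i + 1) (p - 1) - d k, as then d k + i = i p + (p - 1 - c). *)

Import Order.TTheory GRing.Theory Num.Theory.
Local Open Scope ring_scope.

(** * Power sums and binomials in characteristic p *)

Lemma expf_card_pred (F : finFieldType) (x : F) : x != 0 -> x ^+ #|F|.-1 = 1.
Proof.
move=> x0; apply: (mulfI x0); rewrite mulr1 -exprS prednK ?expf_card //.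
exact: ltnW (finNzRing_gt1 F).
Qed.

(** Let q be the order of F. If q - 1 divides e, each nonzero t contributes 1, and t = 0 contributes
    0 as e > 0, giving q - 1 = -1. Otherwise scaling by some g with g^e other than 1 permutes F and
    forces the sum to vanish. *)
Lemma sum_expf (F : finFieldType) (e : nat) :
  (0 < e)%N -> \sum_(t : F) t ^+ e = - (#|F|.-1 %| e)%:R.
Proof.
move=> e_gt0; have F_gt1 := finNzRing_gt1 F.
have [dvd_e|ndvd_e] := boolP (_ %| e)%N.
  rewrite (bigD1 0) //= expr0n gtn_eqF // add0r.
  rewrite (eq_bigr (fun=> 1)) => [|t t0]; last first.
    by have /dvdnP[m ->] := dvd_e; rewrite mulnC exprM expf_card_pred // expr1n.
  have cardF0 : #|F|%:R = 0 :> F.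
    (* Translation by 1 permutes F but adds q to the sum of its elements. *)
    have : \sum_(t : F) t = \sum_(t : F) (1 + t).
      by rewrite [LHS](reindex_inj (addrI 1)).
    by rewrite big_split /= sumr_const -{1}[\sum_t t]add0r => /addIr.
  rewrite (eq_bigl [in predC1 (0 : F)]) // sumr_const.
  by apply/eqP; rewrite -addr_eq0 cardC1 -natrD addn1 prednK ?cardF0 // ltnW.
(* Only r = e mod (q - 1) matters, and X^r - 1 has at most r < q - 1 roots. *)
have [g g0 ge] : exists2 g : F, g != 0 & g ^+ e != 1.
  set r := (e %% #|F|.-1)%N.
  have r_gt0 : (0 < r)%N by rewrite lt0n.
  have r_lt : (r < #|F|.-1)%N by rewrite ltn_mod -subn1 subn_gt0.
  have [/existsP[g /andP[g0 gr]]|] :=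
      boolP [exists g : F, (g != 0) && (g ^+ r != 1)].
    exists g => //; rewrite (divn_eq e #|F|.-1) exprD mulnC exprM expf_card_pred //.
    by rewrite expr1n mul1r.
  rewrite negb_exists => /forallP all1.
  have := @max_unity_roots F r (enum (predC1 (0 : F))) r_gt0.
  rewrite -cardE cardC1 enum_uniq leqNgt r_lt => /(_ _ isT) -/(_ _)/negP[] //.
  apply/allP=> t; rewrite mem_enum inE => t0; apply/unity_rootP/eqP.
  by have := all1 t; rewrite t0 /= negbK.
apply/eqP; rewrite oppr0; set S := \sum_t _.
have : g ^+ e * S = S.
  rewrite /S mulr_sumr [RHS](reindex_inj (mulfI g0)) /=.
  by apply: eq_bigr => t _; rewrite exprMn.
move/eqP; rewrite -subr_eq0 -{2}[S]mul1r -mulrBl mulf_eq0 subr_eq0 (negPf ge).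
by [].
Qed.

(** Multiplied by x - y, both sides become x^p - y^p: the left by Frobenius, the right by
    telescoping. For x = y the right side is p equal terms. *)
Lemma subr_expp1 (p : nat) (F : fieldType) (x y : F) : p \in [pchar F] ->
  (x - y) ^+ p.-1 = \sum_(c < p) x ^+ (p.-1 - c) * y ^+ c.
Proof.
move=> pF; have p_gt0 := prime_gt0 (pcharf_prime pF).
have [->|xy] := eqVneq x y.
  rewrite subrr (eq_bigr (fun=> y ^+ p.-1)) => [|c _]; last first.
    by rewrite -exprD subnK // -ltnS prednK.
  rewrite sumr_const card_ord -mulr_natr pcharf0 // mulr0 expr0n.
  by have := prime_gt1 (pcharf_prime pF); case: (p) => [|[]].
have xy0 : x - y != 0 by rewrite subr_eq0.
apply: (mulfI xy0); rewrite -subrXX -exprS prednK //.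
by have := pFrobenius_autB_comm pF (mulrC x y); rewrite !pFrobenius_autE.
Qed.

Lemma natr_ffact (R : pzRingType) (n k : nat) :
  (n ^_ k)%:R = \prod_(j < k) (n%:R - j%:R) :> R.
Proof.
elim: k => [|k IH]; first by rewrite big_ord0 ffactn0.
rewrite big_ord_recr /= -IH ffactnSr natrM.
have [le_kn|lt_nk] := leqP k n; first by rewrite natrB.
by rewrite ffact_small // !mul0r.
Qed.

(* Lucas' theorem for k < p: k! is invertible, and k! C(n, k) is a polynomial
   in n. *)
Lemma natr_bin_pchar (p : nat) (F : fieldType) (n m k : nat) :
  p \in [pchar F] -> (k < p)%N -> n%:R = m%:R :> F ->
  'C(n, k)%:R = 'C(m, k)%:R :> F.
Proof.
move=> pF lt_kp eq_nm.
have k0 : k`!%:R != 0 :> F.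
  elim: k lt_kp => [|k IH] lt_kp; first by rewrite oner_eq0.
  rewrite factS natrM mulf_neq0 ?IH ?(ltnW lt_kp) //.
  by rewrite -(dvdn_pcharf pF) gtnNdvd.
by apply: (mulIf k0); rewrite -!natrM !bin_ffact !natr_ffact eq_nm.
Qed.

(** * From projective points to roots of a trinomial *)

Section Points.
Variable F : finFieldType.

Let affine_point (t : F) : 'rV[F]_2 := \row_j (if j == 0 then t else 1).

Lemma affine_pointE t : (affine_point t 0 0 = t) * (affine_point t 0 1 = 1).
Proof. by rewrite !mxE. Qed.

Lemma dwork_formZ (d : nat) (mu c : F) (v : 'rV[F]_2) : (0 < d)%N ->
  dwork_form d mu (c *: v) = c ^+ d * dwork_form d mu v.
Proof.
case: d => // d _; rewrite /dwork_form !mxE subn1 /= !exprMn.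
by rewrite exprS; ring.
Qed.

(* The point (1 : 0) is not on the hypersurface, so all its points lie in the
   chart x_2 = 1. *)
Lemma card_proj_zeros_dwork (d : nat) (mu : F) : (1 < d)%N ->
  #|proj_zeros (dwork_form d mu)| =
  #|[set t : F | t ^+ d + 1 - d%:R * mu * t == 0]|.
Proof.
move=> d_gt1; have d_gt0 := ltnW d_gt1.
pose cls (v : 'rV[F]_2) := [set w in [set w | w != 0] | proportional v w].
have aff0 t : affine_point t != 0.
  by apply/eqP => /rowP/(_ 1)/eqP; rewrite affine_pointE mxE oner_eq0.
have cls_refl v : v != 0 -> v \in cls v.
  move=> v0; rewrite !inE v0; apply/existsP; exists 1.
  by rewrite oner_eq0 scale1r eqxx.
have form_aff t : dwork_form d mu (affine_point t) =
    t ^+ d + 1 - d%:R * mu * t.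
  by rewrite /dwork_form !affine_pointE !expr1n mulr1.
(* Distinct t give distinct classes: the second coordinates force the scalar to be 1. *)
rewrite -(card_imset (f := fun t => cls (affine_point t))); last first.
  move=> t s eq_ts; have := cls_refl _ (aff0 s).
  rewrite -eq_ts !inE => /andP[_ /existsP[c /andP[_ /eqP/rowP E]]].
  have := E 1; have := E 0; rewrite !mxE /= mulr1 => -> <-.
  by rewrite mul1r.
congr #|pred_of_set _|; apply/setP => P; rewrite !inE; apply/andP/imsetP.
  case=> /imsetP[v]; rewrite inE => v0 ->{P} /forall_inP zP.
  have : dwork_form d mu v == 0 by apply: zP; apply: cls_refl.
  have [v1_0|v1_0] := eqVneq (v 0 1) 0.
    rewrite /dwork_form v1_0 !expr0n subn_eq0 leqNgt d_gt1 gtn_eqF //.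
    rewrite mulr0 subr0 addr0 expf_eq0 d_gt0 /= => v0_0; case/eqP: v0.
    apply/rowP => j; rewrite mxE; case: j => -[|[|//]] lt_j.
      by rewrite -(eqP v0_0); congr (v 0 _); apply: val_inj.
    by rewrite -v1_0; congr (v 0 _); apply: val_inj.
  have def_v : v = v 0 1 *: affine_point (v 0 0 / v 0 1).
    apply/rowP => j; rewrite !mxE; case: j => -[|[|//]] lt_j /=.
      by rewrite mulrC divfK //; congr (v 0 _); apply: val_inj.
    by rewrite mulr1; congr (v 0 _); apply: val_inj.
  rewrite {1}def_v dwork_formZ // mulf_eq0 expf_eq0 d_gt0 (negPf v1_0) /=.
  rewrite form_aff => z; exists (v 0 0 / v 0 1); first by rewrite inE.
  apply/setP => w; rewrite !inE; congr (_ && _); apply/existsP/existsP.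
    case=> c /andP[c0 /eqP ->]; exists (c * v 0 1).
    by rewrite mulf_neq0 //= -scalerA -def_v.
  case=> c /andP[c0 /eqP ->]; exists (c / v 0 1).
  by rewrite mulf_neq0 ?invr_eq0 //= [X in _ == _ *: X]def_v scalerA divfK.
case=> t; rewrite inE => zt ->; split.
  by apply/imsetP; exists (affine_point t); rewrite ?inE.
apply/forall_inP => w; rewrite !inE => /andP[_ /existsP[c /andP[_ /eqP ->]]].
by rewrite dwork_formZ // form_aff (eqP zt) mulr0.
Qed.
End Points.

(** * Reduction of p-integral rationals to F_p *)

(** The reduction map from Z_(p), as a relation: any fraction with denominator prime to p may
    witness it, so sums and products transfer without passing to lowest terms. *)
Definition reduces (p : nat) (x : rat) (u : 'F_p) : Prop :=
  exists n m : int, [/\ m%:~R != 0 :> 'F_p, x = n%:~R / m%:~R &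
                        u = n%:~R / m%:~R].

Section Reduction.
Variables (p : nat) (p_pr : prime p).

Let intr_rat_neq0 (m : int) : m%:~R != 0 :> 'F_p -> m%:~R != 0 :> rat.
Proof. by apply: contraNneq => /eqP; rewrite intr_eq0 => /eqP ->. Qed.

Lemma reduces_int (n : int) : reduces p n%:~R n%:~R.
Proof. by exists n, 1; rewrite !divr1 oner_eq0. Qed.

Lemma reducesD x y u v :
  reduces p x u -> reduces p y v -> reduces p (x + y) (u + v).
Proof.
case=> n [m [m0 -> ->]] [n' [m' [m'0 -> ->]]].
exists (n * m' + n' * m), (m * m'); rewrite !intrM !intrD !intrM mulf_neq0 //.
by rewrite !addf_div ?intr_rat_neq0.
Qed.

Lemma reducesM x y u v :
  reduces p x u -> reduces p y v -> reduces p (x * y) (u * v).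
Proof.
case=> n [m [m0 -> ->]] [n' [m' [m'0 -> ->]]].
by exists (n * n'), (m * m'); rewrite !intrM mulf_neq0 // !mulf_div.
Qed.

Lemma reducesV (m : int) :
  m%:~R != 0 :> 'F_p -> reduces p m%:~R^-1 m%:~R^-1.
Proof. by exists 1, m; rewrite !div1r. Qed.

Lemma reduces_sum (I : Type) (r : seq I) (P : pred I) (x : I -> rat)
    (u : I -> 'F_p) : (forall i, P i -> reduces p (x i) (u i)) ->
  reduces p (\sum_(i <- r | P i) x i) (\sum_(i <- r | P i) u i).
Proof.
move=> red_xu; apply: (big_rec2 (reduces p)) => [|i y v Pi red_yv].
  exact: reduces_int 0.
by apply: reducesD; first exact: red_xu.
Qed.

(** The denominator in lowest terms divides every other denominator, here m. *)
Lemma p_integral_div (n m : int) :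
  m%:~R != 0 :> 'F_p -> p_integral p (n%:~R / m%:~R).
Proof.
move=> m0; have mQ0 := intr_rat_neq0 m m0.
rewrite /p_integral prime_coprime //; apply: contra m0 => dvd_p.
rewrite -(dvdz_pcharf (pchar_Fp p_pr)) -[(p %| m)%Z]/(p %| `|m|)%N.
apply: dvdn_trans dvd_p _.
set x := _ / _; have : x * m%:~R = n%:~R by rewrite divfK.
rewrite -{1}(divq_num_den x) mulrAC => /(canRL (mulfVK _)).
rewrite intr_eq0 denq_eq0 => /(_ isT); rewrite -!intrM => /intr_inj Exm.
have : (`|denq x| %| `|numq x| * `|m|)%N.
  by rewrite -abszM Exm abszM dvdn_mull.
by rewrite Gauss_dvdr // coprime_sym coprime_num_den.
Qed.

Lemma congr_Zp_reduces x y (u : 'F_p) :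
  reduces p x u -> reduces p y u -> congr_Zp p x y.
Proof.
case=> n [m [m0 -> ->]] [n' [m' [m'0 -> /eqP Euv]]].
split; [exact: p_integral_div | exact: p_integral_div |].
have : (p %| n * m' - n' * m)%Z.
  rewrite (dvdz_pcharf (pchar_Fp p_pr)) intrD intrN !intrM subr_eq0.
  by rewrite -eqr_div.
case/dvdzP=> k Ek; exists (k%:~R / (m * m')%:~R).
  by apply: p_integral_div; rewrite intrM mulf_neq0.
rewrite -mulNr addf_div ?intr_rat_neq0 // mulNr -!intrM -intrN -intrD Ek.
by rewrite mulrA intrM [p%:R * _]mulrC.
Qed.
End Reduction.

(** * Closed form of the hypergeometric coefficients *)

Lemma fact_interval (n i l : nat) : (i <= l)%N ->
  ((n + l)`! = (n + i)`! * \prod_(i.+1 <= k < l.+1) (n + k))%N.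
Proof.
elim: l => [|l IH]; first by rewrite leqn0 => /eqP ->; rewrite big_geq // muln1.
rewrite leq_eqVlt => /predU1P[->|]; first by rewrite big_geq // muln1.
by rewrite ltnS => le_il; rewrite big_nat_recr //= mulnA -IH // addnS factS mulnC.
Qed.

Lemma prod_shift_params (R : comPzRingType) (f : rat -> R) (m i : nat) :
  (i < m)%N ->
  \prod_(a <- shift_params i [seq k%:R / m%:R | k <- iota 1 (m - 1)]) f a =
  (\prod_(1 <= k < i.+1) f (k%:R / m%:R + 1)) *
  \prod_(i.+1 <= k < m) f (k%:R / m%:R).
Proof.
move=> lt_im; rewrite /shift_params big_cat !big_map.
have -> : (m - 1 = i + (m - i.+1))%N by lia.
rewrite iotaD map_cat take_size_cat ?drop_size_cat ?size_map ?size_iota //.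
by rewrite !big_map /index_iota subn1.
Qed.

(** Passing from k to k + 1 brings in factors with denominator m whose numerators are the integers
    from m k + i + 1 to m (k + 1) + i, except m (k + 1). The missing one accounts for the k! and for
    one more power of m in the denominator. *)
Lemma prod_pochhammer_shift_params (m i k : nat) : (i < m)%N ->
  \prod_(a <- shift_params i [seq j%:R / m%:R | j <- iota 1 (m - 1)])
     pochhammer a k =
  ((m * k + i)`!)%:R / (i`!%:R * m%:R ^+ (m * k) * k`!%:R).
Proof.
move=> lt_im; have m0 : m%:R != 0 :> rat by rewrite pnatr_eq0; lia.
elim: k => [|k IH].
  rewrite big1 => [|a _]; last by rewrite /pochhammer big_ord0.
  by rewrite muln0 add0n fact0 mulr1 expr0 mulr1 divff // pnatr_eq0 -lt0n fact_gt0.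
under eq_bigr do rewrite /pochhammer big_ord_recr /= -/(pochhammer _ k).
rewrite big_split /= IH prod_shift_params //.
have -> : \prod_(1 <= j < i.+1) (j%:R / m%:R + 1 + k%:R : rat) =
    (\prod_(1 <= j < i.+1) (m * k.+1 + j))%:R / m%:R ^+ i.
  have -> : m%:R ^+ i = \prod_(1 <= j < i.+1) m%:R :> rat.
    by rewrite prodr_const_nat subn1.
  rewrite natr_prod -prodf_div.
  by apply: eq_bigr => j _; rewrite mulnS !natrD natrM; field.
have -> : \prod_(i.+1 <= j < m) (j%:R / m%:R + k%:R : rat) =
    (\prod_(i.+1 <= j < m) (m * k + j))%:R / m%:R ^+ (m - i.+1).
  rewrite -prodr_const_nat natr_prod -prodf_div.
  by apply: eq_bigr => j _; rewrite natrD natrM; field.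
have -> : ((m * k.+1 + i)`! = (m * k + i)`! *
    \prod_(i.+1 <= j < m) (m * k + j) * (m * k.+1) *
    \prod_(1 <= j < i.+1) (m * k.+1 + j))%N.
  rewrite (@fact_interval _ 0 i) // addn0; congr (_ * _)%N.
  case: m {IH m0} lt_im => // m lt_im.
  rewrite -(@fact_interval _ _ m) // mulnS addSn [(m + _)%N]addnC.
  by rewrite factS mulnC.
have -> : m%:R ^+ (m * k.+1) =
    m%:R ^+ (m * k) * m%:R ^+ i * m%:R ^+ (m - i.+1) * m%:R :> rat.
  by rewrite -!exprD -exprSr; congr (_ ^+ _); rewrite mulnS; lia.
have nz n : n`!%:R != 0 :> rat by rewrite pnatr_eq0 -lt0n fact_gt0.
have k0 : k.+1%:R != 0 :> rat by rewrite pnatr_eq0.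
rewrite [k.+1`!]factS !natrM; field.
by rewrite !nz nat1r k0 m0 !expf_neq0.
Qed.

(** With d = m + 1, the products over alpha and beta are the previous formula at m + 1 and at m; the
    i! cancel and the factorials left form the binomial. *)
Lemma hypergeometric_shift_params (m i k : nat) : (i < m)%N ->
  hypergeometric (shift_params i (alpha_params m.+1))
                 (shift_params i (beta_params m.+1)) k =
  'C(m.+1 * k + i, k)%:R * m%:R ^+ (m * k) / m.+1%:R ^+ (m.+1 * k) :> rat.
Proof.
move=> lt_im; rewrite /hypergeometric /alpha_params /beta_params.
have -> : (m.+1 - 2 = m - 1)%N by lia.
rewrite (@prod_pochhammer_shift_params m.+1) ?leqW //.
rewrite [in (m.+1 - 1)%:R]subn1 prod_pochhammer_shift_params //.
have nz n : n`!%:R != 0 :> rat by rewrite pnatr_eq0 -lt0n fact_gt0.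
have m0 : m%:R ^+ (m * k) != 0 :> rat by rewrite expf_neq0 // pnatr_eq0; lia.
have d0 : m.+1%:R ^+ (m.+1 * k) != 0 :> rat by rewrite expf_neq0 // pnatr_eq0.
have le_k : (k <= m.+1 * k + i)%N by lia.
rewrite -(bin_fact le_k).
have -> : (m.+1 * k + i - k = m * k + i)%N by lia.
rewrite !natrM; move: (m%:R ^+ _) (m.+1%:R ^+ _) m0 d0 => M D M0 D0.
field.
by rewrite !nz M0 D0.
Qed.

(** Frees the index range from [Num.truncn b], so that the series can be indexed below p like the
    count. *)
Lemma horner_truncation (u : nat -> rat) (a b x : rat) (n : nat) :
  (forall k, k%:R <= b -> (k < n)%N) ->
  (truncation u a b).[x] = \sum_(k < n | a <= k%:R <= b) u k * x ^+ k.
Proof.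
move=> lt_n; rewrite /truncation horner_sum.
have widen N M : (N <= M)%N -> (forall k, k%:R <= b -> (k < N)%N) ->
    \sum_(k < N | a <= k%:R <= b) u k * x ^+ k =
    \sum_(k < M | a <= k%:R <= b) u k * x ^+ k.
  move=> le_NM ltN.
  rewrite (big_ord_widen_cond M (fun k => a <= k%:R <= b)
    (fun k => u k * x ^+ k)) //.
  by apply: eq_bigl => k; apply: andb_idr => /andP[_ /ltN].
rewrite (widen n (n + (Num.truncn b).+1)%N) ?leq_addr //.
rewrite -(widen (Num.truncn b).+1) ?leq_addl // => [|k le_kb].
  by apply: eq_bigr => k _; rewrite hornerZ hornerXn.
(* Here 0 <= k <= b, so b is nonnegative, as [truncn_ge_nat] requires. *)
by rewrite ltnS truncn_ge_nat // (le_trans _ le_kb).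
Qed.

(** * The point count modulo p as a sum of binomials *)

Section PointCount.
Variables (p : nat) (p_pr : prime p).
Local Notation F := 'F_p.

Let pF : p \in [pchar F]. Proof. exact: pchar_Fp. Qed.
Let p_gt1 : (1 < p)%N. Proof. exact: prime_gt1. Qed.

Lemma expf_Fp (x : F) : x != 0 -> x ^+ p.-1 = 1.
Proof. by move/expf_card_pred; rewrite card_Fp. Qed.

(** By Fermat, 1 - x^(p-1) is the indicator of x = 0. *)
Lemma natr_card_zeros (g : F -> F) :
  #|[set t | g t == 0]|%:R = \sum_t (1 - g t ^+ p.-1).
Proof.
rewrite -sum1_card natr_sum big_mkcond /=; apply: eq_bigr => t _.
rewrite inE; have [->|gt0] := eqVneq (g t) 0.
  by rewrite expr0n gtn_eqF ?subr0 // -subn1 subn_gt0.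
by rewrite expf_Fp // subrr.
Qed.

Lemma sum_trinomial_expp1 (d : nat) (e : F) :
  \sum_t (t ^+ d + 1 - e * t) ^+ p.-1 =
  \sum_(c < p) \sum_(a < p | (a + c < p)%N)
    'C(p.-1 - c, a)%:R * e ^+ c * \sum_t t ^+ (d * a + c).
Proof.
under eq_bigr => t _ do rewrite (subr_expp1 p) //.
rewrite exchange_big; apply: eq_bigr => c _.
under [RHS]eq_bigr do rewrite mulr_sumr.
rewrite [RHS]exchange_big; apply: eq_bigr => t _.
rewrite [t ^+ d + 1]addrC exprDn mulr_suml.
have le_p : ((p.-1 - c).+1 <= p)%N by lia.
rewrite (big_ord_widen _ (fun i => 1 ^+ (p.-1 - c - i) * t ^+ d ^+ i
  *+ 'C(p.-1 - c, i) * (e * t) ^+ c) le_p).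
apply: eq_big => [a|a _]; first by have := ltn_ord c; lia.
by rewrite expr1n mul1r -mulr_natl exprMn exprD exprM; ring.
Qed.

(** The terms with c = 0 do not involve e and cancel; those with c > 0 vanish for e = 0, and their
    power sums have positive exponent. *)
Lemma natr_card_zeros_trinomial (d : nat) (e : F) :
  #|[set t : F | t ^+ d + 1 - e * t == 0]|%:R -
  #|[set t : F | t ^+ d + 1 - 0 * t == 0]|%:R =
  \sum_(c < p | (0 < c)%N) \sum_(a < p | (a + c < p)%N)
    if (p.-1 %| d * a + c)%N then 'C(p.-1 - c, a)%:R * e ^+ c else 0 :> F.
Proof.
rewrite !natr_card_zeros !sumrB opprB addrC subrKA !sum_trinomial_expp1.
rewrite -sumrB [RHS]big_mkcond; apply: eq_bigr => c _; rewrite -sumrB.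
case: posnP => [->|c_gt0]; first by apply: big1 => a _; rewrite !expr0 subrr.
apply: eq_bigr => a _; rewrite expr0n gtn_eqF // mulr0 mul0r sub0r.
rewrite sum_expf ?addn_gt0 ?c_gt0 ?orbT // card_Fp //.
by case: ifP => _; rewrite mulrN opprK ?mulr1n ?mulr0n ?mulr1 ?mulr0.
Qed.

Lemma sum_truncated_binomials (d : nat) (e : F) : (1 < d)%N -> (d %| p - 1)%N ->
  e != 0 ->
  \sum_(0 <= i < d - 1) \sum_(k < p | ((i * (p - 1) <= (d - 1) * k) &&
                                (d * k + d <= i.+1 * (p - 1)))%N)
    'C(d * k + i, k)%:R / e ^+ (d * k) =
  \sum_(c < p | (0 < c)%N) \sum_(a < p | (a + c < p)%N)
    if (p.-1 %| d * a + c)%N then 'C(p.-1 - c, a)%:R * e ^+ c else 0 :> F.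
Proof.
move=> d_gt1 d_dvd e0.
(* The terms of the count are sorted by the quotient i + 1 of d a + c by p - 1. *)
pose T (c a i : nat) : F :=
  if [&& (0 < c)%N, (a + c < p)%N & (d * a + c == i.+1 * p.-1)%N]
  then 'C(p.-1 - c, a)%:R * e ^+ c else 0.
transitivity (\sum_(c < p) \sum_(a < p) \sum_(0 <= i < d - 1) T c a i).
  rewrite exchange_big; under [RHS]eq_bigr do rewrite exchange_big.
  rewrite [RHS]exchange_big; apply: eq_big_nat => i /andP[_ lt_i].
  rewrite [LHS]big_mkcond; apply: eq_bigr => k _.
  case: ifP => [/andP[le1 le2]|cond].
    pose c := (i.+1 * (p - 1) - d * k)%N.
    have lt_c : (c < p)%N by rewrite /c; nia.
    rewrite (bigD1 (Ordinal lt_c)) //= big1 => [|c' ne_c]; last first.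
      rewrite /T; case: ifP => // /and3P[_ _ /eqP E]; case/eqP: ne_c.
      by apply: val_inj; rewrite /= /c -subn1 in E *; lia.
    rewrite addr0 /T ifT; last by rewrite /c -subn1; nia.
    congr (_ * _).
      apply: (natr_bin_pchar p) => //.
      have -> : (d * k + i = i * p + (p.-1 - c))%N by rewrite /c -subn1; nia.
      by rewrite natrD natrM (pcharf0 pF) mulr0 add0r.
    (* As d k + c is a multiple of p - 1, e^c is the inverse of e^(d k). *)
    apply: (mulIf (expf_neq0 (d * k) e0)); rewrite mulVf ?expf_neq0 //.
    rewrite -exprD subnK ?(leq_trans (leq_addr d _) le2) //.
    by rewrite subn1 mulnC exprM expf_Fp // expr1n.
  rewrite big1 // => c _; rewrite /T; case: ifP => // /and3P[c_gt0 lt_p /eqP E].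
  case/negP: (negbT cond); apply/andP; split; first by nia.
  (* This is c > 0. Both sides are multiples of d, so the gap is at least d: hence the -1 in the
     upper truncation bound. *)
  have : (d * k < i.+1 * (p - 1))%N by nia.
  case/dvdnP: d_dvd => q ->; rewrite mulnA [(_ * d)%N]mulnC ltn_pmul2l; last by lia.
  by nia.
rewrite [RHS]big_mkcond; apply: eq_bigr => c _.
case: posnP => [c0|c_gt0].
  by rewrite big1 // => a _; rewrite big1 // => i _; rewrite /T c0.
rewrite [RHS]big_mkcond; apply: eq_bigr => a _.
case: ifP => [lt_p|nlt_p]; last by rewrite big1 // => i _; rewrite /T nlt_p andbF.
case: ifP => [/dvdnP[m Em]|ndvd]; last first.
  rewrite big1 // => i _; rewrite /T; case: ifP => // /and3P[_ _ /eqP E].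
  by rewrite E dvdn_mull in ndvd.
have m_gt0 : (0 < m)%N by nia.
(* Since c > 0 and d > 1, d a + c < d (a + c) <= d (p - 1), so m < d. *)
have lt_m : (m.-1 < d - 1)%N by nia.
rewrite big_mkord (bigD1 (Ordinal lt_m)) //= big1 => [|i ne_i].
  by rewrite addr0 /T c_gt0 lt_p prednK // Em eqxx.
rewrite /T Em; case: ifP => // /and3P[_ _]; rewrite eqn_pmul2r => [/eqP E|].
  by case/eqP: ne_i; apply: val_inj; rewrite /= E.
by rewrite -subn1 subn_gt0.
Qed.
End PointCount.

Theorem theorem5p5 (d p : nat) (lambda : int)
    (hd : (2 <= d)%N) (hp : prime p) (hdp : (d %| p - 1)%N)
    (hlambda : ~~ (p%:Z %| lambda)%Z) :
  congr_Zp p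
    ((num_points p d lambda)%:R - (num_points p d 0)%:R)
    (\sum_(0 <= i < d - 1)
       (truncation
          (hypergeometric (shift_params i (alpha_params d))
                          (shift_params i (beta_params d)))
          ((i * (p - 1))%:R / (d - 1)%:R)
          ((i.+1 * (p - 1))%:R / d%:R - 1)
       ).[(d - 1)%:R ^- (d - 1) * lambda%:~R ^- d]).
Proof.
have pF := pchar_Fp hp.
have p_gt1 := prime_gt1 hp.
have le_dp : (d <= p - 1)%N by apply: dvdn_leq; rewrite // subn_gt0.
pose e : int := d%:Z * lambda.
have e0 : e%:~R != 0 :> 'F_p.
  rewrite intrM mulf_neq0 // -(dvdz_pcharf pF) //.
  by rewrite -[(_ %| _)%Z]/(p %| d)%N gtnNdvd //; lia.
have dQ0 : d%:R != 0 :> rat by rewrite pnatr_eq0; lia.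
have lambda0 : lambda%:~R != 0 :> rat.
  by rewrite intr_eq0; apply: contraNneq hlambda => ->; rewrite dvdz0.
(* The common residue is the difference of the counts, read in F_p. *)
apply: (congr_Zp_reduces p hp _ _
  ((num_points p d lambda)%:R - (num_points p d 0)%:R)).
  have := reduces_int p ((num_points p d lambda)%:Z - (num_points p d 0)%:Z).
  by rewrite !intrB.
rewrite /num_points !card_proj_zeros_dwork // mulr0.
rewrite (_ : d%:R * lambda%:~R = e%:~R); last by rewrite intrM.
rewrite natr_card_zeros_trinomial // -sum_truncated_binomials //.
rewrite big_nat [X in reduces p _ X]big_nat; apply: reduces_sum => i /= lt_i.
(* As i + 1 < d, the upper bound lies below p. *)
rewrite (horner_truncation _ _ _ _ p) => [|k]; last first.
  rewrite lerBrDr ler_pdivlMr ?ltr0n; last by lia.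
  by rewrite natr1 -natrM ler_nat; nia.
rewrite [X in reduces p X _](eq_bigl (fun k : 'I_p =>
    ((i * (p - 1) <= (d - 1) * k) && (d * k + d <= i.+1 * (p - 1)))%N)); last first.
  move=> k /=; rewrite ler_pdivrMr ?ltr0n; last by lia.
  rewrite lerBrDr ler_pdivlMr ?ltr0n; last by lia.
  by rewrite natr1 -!natrM !ler_nat [(k * _)%N]mulnC [(k.+1 * d)%N]mulnC mulnSr.
apply: reduces_sum => k _.
(* The powers of d - 1 cancel, leaving a denominator (d lambda)^(d k) prime to p. *)
have -> : hypergeometric (shift_params i (alpha_params d))
            (shift_params i (beta_params d)) k *
    ((d - 1)%:R ^- (d - 1) * lambda%:~R ^- d) ^+ k =
    'C(d * k + i, k)%:Z%:~R / (e ^+ (d * k))%:~R.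
  case: d hd lt_i dQ0 @e {e0 hdp le_dp} => // m m_gt0 lt_im dQ0 e.
  rewrite subn1 /= in lt_im *.
  rewrite hypergeometric_shift_params // rmorphXn /= intrM.
  rewrite exprMn exprMn_comm ?exprVn -?exprM; last exact: mulrC.
  have m0 : m%:R != 0 :> rat by rewrite pnatr_eq0; lia.
  by field; rewrite !expf_neq0.
have -> : 'C(d * k + i, k)%:R / e%:~R ^+ (d * k) =
    'C(d * k + i, k)%:Z%:~R / (e ^+ (d * k))%:~R :> 'F_p by rewrite rmorphXn.
apply: reducesM; first exact: reduces_int.
by apply: reducesV; rewrite rmorphXn expf_neq0.
Qed.
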